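(* Let $S$ be a positive trace class operator on $L^2(\mathbb{R}^d)$ with $\mathrm{tr}(S)=1$, and consider the positive operator valued measure $F(\Omega)=\chi_\Omega\star S$ on $\mathbb{R}^{2d}$. For $\psi\in L^2(\mathbb{R}^d)$ with $\|\psi\|_{L^2}=1$, the induced probability measure $\mu_\psi^F$ on $\mathbb{R}^{2d}$ is given by $$\mu_\psi^F(\Omega)=\iint_\Omega\big((\psi\otimes\psi)\star\check S\big)(z)\,dz$$ for measurable $\Omega\subset\mathbb{R}^{2d}$. In other words, the Radon-Nikodym derivative of $\mu_\psi^F$ with respect to Lebesgue measure $dz$ is the Cohen's class distribution $Q_S(\psi)=(\psi\otimes\psi)\star\check S$.
   Context: For $z=(x,\omega)\in\mathbb{R}^{2d}$, $\pi(z)\psi(t)=e^{2\pi i\omega\cdot t}\psi(t-x)$, $\alpha_z(A)=\pi(z)A\pi(z)^*$; $P\psi(x)=\psi(-x)$, $\check A=PAP$; $(\psi\otimes\psi)\zeta=\langle\zeta,\psi\rangle\psi$. For $f\in L^\infty(\mathbb{R}^{2d})$ and $S$ trace class, $f\star S$ is the bounded operator determined by $\mathrm{tr}((f\star S)T)=\iint_{\mathbb{R}^{2d}}f(z)(\check S\star T)(z)\,dz$ for all trace class $T$, where for trace class $R,T$ one sets $R\star T(z)=\mathrm{tr}(R\,\alpha_z(\check T))$ (a commutative operation with values in $L^1(\mathbb{R}^{2d})$). The map $\Omega\mapsto F(\Omega)=\chi_\Omega\star S$ is a positive operator valued measure (positive operator values, $F(\mathbb{R}^{2d})=I$, countably additive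 in the weak operator topology), and the induced measure is $\mu_\psi^F(\Omega)=\langle F(\Omega)\psi,\psi\rangle$. *)

(* Defs.v *)
From HB Require Import structures.
From mathcomp Require Import all_boot all_order all_algebra.
From mathcomp Require Import complex.
From mathcomp Require Import all_classical all_reals all_analysis.

Set Implicit Arguments.
Unset Strict Implicit.
Unset Printing Implicit Defensive.
Import Order.TTheory GRing.Theory Num.Theory.
Import numFieldNormedType.Exports.
Local Open Scope classical_set_scope.
Local Open Scope ring_scope.
Local Open Scope complex_scope.

(* A copy of [m1 \x m2]: on [\x] itself, the sigma-finite canonical instance
   is only found when m1 and m2 are subprobabilities. *)
Section sprod.
Context d1 d2 (T1 : measurableType d1) (T2 : measurableType d2) (R : realType).
Variable m1 : {sigma_finite_measure set T1 -> \bar R}.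
Variable m2 : {sigma_finite_measure set T2 -> \bar R}.

Definition sprod : set (T1 * T2) -> \bar R := (m1 \x m2)%E.

HB.instance Definition _ := Measure.copy sprod
  (lebesgue_integral_fubini_product_measure1__canonical__measure_function_Measure
     m1 m2).

Let sigma_finite_sprod : sigma_finite setT sprod.
Proof.
have /sigma_finiteP[F [TF ndF Foo]] := sigma_finiteT m1.
have /sigma_finiteP[G [TG ndG Goo]] := sigma_finiteT m2.
exists (fun n => F n `*` G n).
  rewrite -setXTT TF TG predeqE => -[x y]; split.
    move=> [/= [n _ Fnx] [k _ Gky]]; exists (maxn n k) => //; split.
    - by move: x Fnx; exact/subsetPset/ndF/leq_maxl.
    - by move: y Gky; exact/subsetPset/ndG/leq_maxr.
  by move=> [n _ []/= ? ?]; split; exists n.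
move=> k; have [mFk Fk] := Foo k; have [mGk Gk] := Goo k.
split; first exact: measurableX.
by rewrite /sprod product_measure1E// lte_mul_pinfty// ge0_fin_numE.
Qed.

HB.instance Definition _ :=
  Measure_isSigmaFinite.Build _ _ _ sprod sigma_finite_sprod.

End sprod.

(* A measurable type, unlike ['rV[R]_n]. *)
Notation Rn R n := (n.-tuple (measurableTypeR R)).

Section lebesgue_step.
Context (R : realType) (n : nat).

Definition tuple_cons (p : measurableTypeR R * Rn R n) : Rn R n.+1 :=
  [the n.+1.-tuple _ of p.1 :: p.2].

Lemma measurable_tuple_cons : measurable_fun setT tuple_cons.
Proof. exact: measurable_cons. Qed.

Variable mu : {sigma_finite_measure set (Rn R n) -> \bar R}.

Definition lebesgue_step : set (Rn R n.+1) -> \bar R :=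
  pushforward (sprod lebesgue_measure mu) tuple_cons.

HB.instance Definition _ := Measure.copy lebesgue_step
  (measure_function_pushforward__canonical__measure_function_Measure
     (sprod lebesgue_measure mu) measurable_tuple_cons).

Let sigma_finite_step : sigma_finite setT lebesgue_step.
Proof.
have [F FT mF] := sigma_finiteT (sprod lebesgue_measure mu).
pose unc (t : Rn R n.+1) := (thead t, [tuple of behead t]).
have consK : cancel tuple_cons unc.
  by case=> x t; congr (_, _); exact: val_inj.
have munc : measurable_fun setT unc.
  by apply: measurable_fun_pair;
    [exact: measurable_tnth | exact: measurable_behead].
exists (fun k => unc @^-1` F k).
  by rewrite -preimage_bigcup -FT preimage_setT.
move=> k; have [mFk Fk] := mF k; split.
  by rewrite -[X in measurable X]setTI; exact: munc.
by rewrite /lebesgue_step /pushforward -comp_preimage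
  (_ : unc \o tuple_cons = id) //; apply/funext => p /=; rewrite consK.
Qed.

HB.instance Definition _ :=
  Measure_isSigmaFinite.Build _ _ _ lebesgue_step sigma_finite_step.

End lebesgue_step.

Section lebesgue_0.
Context (R : realType).
Definition lebesgue_0 : set (Rn R 0) -> \bar R := dirac [tuple].
HB.instance Definition _ := FiniteMeasure.on lebesgue_0.
End lebesgue_0.

Fixpoint lebesgue_n (R : realType) (n : nat) :
    {sigma_finite_measure set (Rn R n) -> \bar R} :=
  match n with
  | 0 => @lebesgue_0 R
  | n'.+1 => lebesgue_step (lebesgue_n R n')
  end.

Section complex_integral.
Context dT (T : measurableType dT) (R : realType).
Variable mu : {measure set T -> \bar R}.

Definition cintegrable (D : set T) (f : T -> R[i]) : Prop :=
  mu.-integrable D (fun x => (complex.Re (f x))%:E) /\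
  mu.-integrable D (fun x => (complex.Im (f x))%:E).

Definition cintegral (D : set T) (f : T -> R[i]) : R[i] :=
  (\int[mu]_(x in D) complex.Re (f x)) +i* (\int[mu]_(x in D) complex.Im (f x)).

End complex_integral.

Definition ccvg (R : realType) (u : nat -> R[i]) (l : R[i]) : Prop :=
  (u : nat -> R[i]^o) @ \oo --> (l : R[i]^o).

(* Elements of L^2(R^d) are handled through representatives: [L2 f] says that
   [f : R^d -> C] represents an element of L^2(R^d), and two representatives
   are identified when they are equal almost everywhere. An operator acts on
   representatives; [bounded_op] contains the compatibility with equality
   almost everywhere, so that it is exactly what induces a bounded linear
   operator on the quotient. Only the values on [L2] representatives matter. *)

(* A point z = (x, w) of R^{2d}. *)
Notation phase R d := (Rn R d * Rn R d)%type.

Section operators.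
Context (R : realType) (d : nat).
Local Notation leb := (lebesgue_n R d).

Definition fct := Rn R d -> R[i].
Definition oper := fct -> fct.

Implicit Types (f g psi : fct) (A B S T : oper).

Definition L2 f : Prop :=
  (fun t => complex.Re (f t)) \in Lfun leb 2%:E /\
  (fun t => complex.Im (f t)) \in Lfun leb 2%:E.

(* linear in the first argument *)
Definition inner f g : R[i] := cintegral leb setT (fun t => f t * conjc (g t)).

Definition L2norm f : R := Num.sqrt (complex.Re (inner f f)).

Record bounded_op A : Prop := {
  bounded_op_L2 : forall f, L2 f -> L2 (A f);
  bounded_op_ae : forall f g, L2 f -> L2 g ->
    f = g %[ae leb] -> A f = A g %[ae leb];
  bounded_op_linear : forall (c : R[i]) f g, L2 f -> L2 g ->
    A (fun t => c * f t + g t) = (fun t => c * A f t + A g t) %[ae leb];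
  bounded_op_bounded : exists M : R, forall f, L2 f ->
    L2norm (A f) <= M * L2norm f }.

(* The order on [R[i]] makes [0 <= z] mean that z is real and nonnegative. *)
Definition positive_op A : Prop := forall f, L2 f -> 0 <= inner (A f) f.

(* Any two choices agree almost everywhere on [L2]. *)
Definition adjoint A : oper :=
  xget (fun f => f)
    [set B | bounded_op B /\
      forall f g, L2 f -> L2 g -> inner (A f) g = inner f (B g)].

Record orthonormal_basis (e : nat -> fct) : Prop := {
  onb_L2 : forall n, L2 (e n);
  onb_orthonormal : forall m n, inner (e m) (e n) = (m == n)%:R;
  onb_expansion : forall f, L2 f ->
    (fun n => L2norm (fun t => f t - \sum_(k < n) inner f (e k) * e k t))
      @ \oo --> (0 : R) }.

Definition is_trace A (t : R[i]) : Prop :=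
  exists2 e, orthonormal_basis e &
    ccvg (fun n => \sum_(k < n) inner (A (e k)) (e k)) t.

(* The value does not depend on the basis when A is trace class. *)
Definition trace A : R[i] := xget 0 [set t | is_trace A t].

(* B is |A|, the positive square root of A^* A. *)
Definition trace_class A : Prop :=
  bounded_op A /\
  exists B, [/\ bounded_op B, positive_op B,
    forall f, L2 f -> B (B f) = adjoint A (A f) %[ae leb] &
    exists t, is_trace B t].

Definition rank_one psi : oper := fun zeta t => inner zeta psi * psi t.

Definition parity : oper := fun psi t => psi [tuple - (tnth t i : R) | i < d].

Definition check A : oper := parity \o A \o parity.

Definition dotp (w t : Rn R d) : R :=
  \sum_(i < d) (tnth w i : R) * (tnth t i : R).

(* pi(z) *)
Definition tfshift (z : phase R d) : oper := fun psi t =>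
  (cos (2 * pi * dotp z.2 t) +i* sin (2 * pi * dotp z.2 t)) *
  psi [tuple (tnth t i : R) - (tnth z.1 i : R) | i < d].

Definition alpha (z : phase R d) A : oper :=
  tfshift z \o A \o adjoint (tfshift z).

Definition lebesgue_phase := sprod leb leb.
HB.instance Definition _ := SigmaFiniteMeasure.on lebesgue_phase.

Definition conv_op_op S T (z : phase R d) : R[i] :=
  trace (S \o alpha z (check T)).

(* [B] is the bounded operator f * S. The integrand below is integrable because
   f is bounded and [conv_op_op] takes its values in L^1 on trace class
   operators; this is part of the meaning of the right-hand side, as
   [cintegral] has a default value on functions that are not integrable. *)
Definition is_conv_fun_op (f : phase R d -> R[i]) S B : Prop :=
  bounded_op B /\
  forall T, trace_class T ->
    cintegrable lebesgue_phase setT (fun z => f z * conv_op_op (check S) T z) /\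
    trace (B \o T) =
      cintegral lebesgue_phase setT (fun z => f z * conv_op_op (check S) T z).

Definition cindic (Omega : set (phase R d)) : phase R d -> R[i] :=
  fun z => (\1_Omega z : R)%:C.

(* Q_S(psi) *)
Definition cohen_class S psi : phase R d -> R[i] :=
  conv_op_op (rank_one psi) (check S).

Record is_povm (F : set (phase R d) -> oper) : Prop := {
  povm_bounded : forall Omega, measurable Omega -> bounded_op (F Omega);
  povm_positive : forall Omega, measurable Omega -> positive_op (F Omega);
  povm_setT : forall f, L2 f -> F setT f = f %[ae leb];
  povm_sigma_additive : forall Omega : nat -> set (phase R d),
    (forall n, measurable (Omega n)) -> trivIset setT Omega ->
    forall f g, L2 f -> L2 g ->
    ccvg (fun n => \sum_(k < n) inner (F (Omega k) f) g)
         (inner (F (\bigcup_n Omega n) f) g) }.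

(* mu_psi^F. Its values are complex by type only: [is_povm F] makes them real,
   nonnegative and, for a unit vector psi, at most 1. *)
Definition povm_measure (F : set (phase R d) -> oper) psi
    (Omega : set (phase R d)) : R[i] :=
  inner (F Omega psi) psi.

End operators.

Arguments lebesgue_phase R d : clear implicits.

(* Main.v *)
(* Test the defining identity of F(Omega) = chi_Omega * S against the trace
   class operator T = psi (x) psi. Parseval turns the left side tr(F(Omega) T) into
   <F(Omega) psi, psi>. On the right side, with eta = P pi(z) P psi, both
   (check S * T)(z) and Q_S(psi)(z) equal <S eta, eta>, at every z: the former
   because T is of rank one, the latter because pi(z)^* psi is a unimodular
   multiple of eta. Hence Q_S(psi) is nonnegative and integrates over Omega to
   <F(Omega) psi, psi>; its total mass is |psi|^2 = 1, and uniqueness in the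
   Radon-Nikodym theorem concludes. That pi(z) and P are unitary rests on the
   invariance of the Lebesgue measure of R^d under translations and reflection,
   obtained by induction on d from the uniqueness of product measures. *)

Require Import Defs.
From HB Require Import structures.
From mathcomp Require Import all_boot all_order all_algebra.
From mathcomp Require Import complex.
From mathcomp Require Import all_classical all_reals all_analysis.
From mathcomp Require Import measurable_realfun ring lra.

Set Implicit Arguments.
Unset Strict Implicit.
Unset Printing Implicit Defensive.
Import Order.TTheory GRing.Theory Num.Theory.
Import numFieldNormedType.Exports.
Local Open Scope classical_set_scope.
Local Open Scope ring_scope.
Local Open Scope complex_scope.
Local Open Scope charge_scope.

(** * Measure preserving maps *)

Definition measure_preserving d (T : measurableType d) (R : realType)
    (mu : {measure set T -> \bar R}) (g : T -> T) : Prop :=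
  measurable_fun setT g /\
  forall A, measurable A -> mu (g @^-1` A) = mu A.

(** Lebesgue measure is determined by its values on the intervals ]b, c], and the preimage ]b + a, c
    + a] has the same length. *)
Lemma measure_preserving_shift (R : realType) (a : R) :
  measure_preserving (@lebesgue_measure R)
    ((fun x => x - a) : measurableTypeR R -> measurableTypeR R).
Proof.
have mshift : measurable_fun setT
    ((fun x => x - a) : measurableTypeR R -> measurableTypeR R).
  exact: measurable_funB.
split=> // A mA; apply/esym.
rewrite -[RHS]/(pushforward (@lebesgue_measure R)
  ((fun x => x - a) : measurableTypeR R -> measurableTypeR R) A).
apply: lebesgue_measure_unique => //= _ [[b c]] _ <-.
rewrite /pushforward (_ : _ @^-1` _ = `]b + a, c + a]%classic); last first.
  by apply/seteqP; split=> x /=; rewrite !in_itv/= ltrBrDr lerBlDr.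
rewrite !lebesgue_measure_itv/= !lte_fin ltrD2r.
by rewrite -!EFinB opprD addrACA subrr addr0.
Qed.

Lemma measure_preserving_opp (R : realType) :
  measure_preserving (@lebesgue_measure R)
    ((fun x => - x) : measurableTypeR R -> measurableTypeR R).
Proof.
split; first exact: measurable_funN.
by move=> A mA; exact: lebesgue_measureN.
Qed.

(** The translation inside [tfshift] and the reflection inside [parity] are both of this
    coordinatewise form, so one invariance proof serves both. *)
Definition tuple_map (R : realType) (n : nat)
    (g : 'I_n -> measurableTypeR R -> measurableTypeR R) (t : Rn R n) :
    Rn R n :=
  [tuple g i (tnth t i) | i < n].

Lemma measurable_tuple_map (R : realType) (n : nat)
    (g : 'I_n -> measurableTypeR R -> measurableTypeR R) :
  (forall i, measure_preserving (@lebesgue_measure R) (g i)) ->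
  measurable_fun setT (tuple_map g).
Proof.
move=> gP; apply/measurable_fun_tnthP => i.
rewrite (_ : _ \o _ = g i \o (fun t => tnth t i)); last first.
  by apply/funext => t /=; rewrite tnth_mktuple.
apply: measurableT_comp; first by have [] := gP i.
exact: measurable_tnth.
Qed.

(** Induction on the dimension: through [tuple_cons] the map becomes a product [G] of its first
    coordinate with a coordinatewise map on the tail. In dimension 0 there is only one tuple, so
    every set is its own preimage. *)
Lemma measure_preserving_tuple_map (R : realType) (n : nat)
    (g : 'I_n -> measurableTypeR R -> measurableTypeR R) :
  (forall i, measure_preserving (@lebesgue_measure R) (g i)) ->
  measure_preserving (lebesgue_n R n) (tuple_map g).
Proof.
move=> gP; split; first exact: measurable_tuple_map.
elim: n g gP => [|n IH] g gP A mA.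
  by congr (_ _); apply/seteqP; split=> t /=;
    rewrite (tuple0 t) (tuple0 (tuple_map _ _)).
have mpres0 := gP ord0.
pose G (p : measurableTypeR R * Rn R n) :=
  (g ord0 p.1, tuple_map (fun i => g (lift ord0 i)) p.2).
have consG : tuple_map g \o @tuple_cons R n = @tuple_cons R n \o G.
  apply/funext => p; apply: eq_from_tnth => i; rewrite /= tnth_mktuple.
  have [j ->|->] := unliftP ord0 i; last by rewrite !tnth0.
  by rewrite !tnthS tnth_mktuple.
have mtailmap : measurable_fun setT (tuple_map (fun i => g (lift ord0 i))).
  exact: measurable_tuple_map.
have mG : measurable_fun setT G.
  apply: measurable_fun_pair; apply: measurableT_comp => //.
  by have [] := mpres0.
rewrite /= /lebesgue_step /pushforward -comp_preimage consG comp_preimage.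
set B := @tuple_cons R n @^-1` A.
have mB : measurable B.
  by rewrite /B -[X in measurable X]setTI; exact: measurable_tuple_cons.
(* Uniqueness of the product measure reduces the claim to rectangles, where [G] acts on each side
   separately. *)
apply/esym; rewrite -[RHS]/(pushforward (sprod _ _) G B).
apply: product_measure_unique => // X Y mX mY.
rewrite -[LHS]/((lebesgue_measure \x lebesgue_n R n)%E (g ord0 @^-1` X `*`
  tuple_map (fun i => g (lift ord0 i)) @^-1` Y)) product_measure1E.
- by have [_ ->] := mpres0; rewrite // IH.
- by rewrite -[X in measurable X]setTI; have [+ _] := mpres0; exact.
- by rewrite -[X in measurable X]setTI; exact: mtailmap.
Qed.

(** * Complex integrals *)

Section complex_integral_theory.
Context dT (T : measurableType dT) (R : realType).
Variable mu : {measure set T -> \bar R}.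
Implicit Types (f g : T -> R[i]).

Lemma cintegralD D f g : measurable D ->
  cintegrable mu D f -> cintegrable mu D g ->
  cintegral mu D (fun t => f t + g t) = cintegral mu D f + cintegral mu D g.
Proof.
move=> mD [f1 f2] [g1 g2]; rewrite /cintegral; congr (_ +i* _).
- rewrite -RintegralD//; apply: eq_Rintegral => t _.
  by case: (f t) (g t) => [a b] [a' b'].
- rewrite -RintegralD//; apply: eq_Rintegral => t _.
  by case: (f t) (g t) => [a b] [a' b'].
Qed.

Lemma cintegrableZ D (c : R[i]) f : measurable D ->
  cintegrable mu D f -> cintegrable mu D (fun t => c * f t).
Proof.
case: c => c1 c2 mD [f1 f2]; split.
- apply: (eq_integrable mD _ _ _ (integrableB mD (integrableZl mD c1 f1)
    (integrableZl mD c2 f2))) => t _ /=.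
  by case: (f t).
- apply: (eq_integrable mD _ _ _ (integrableD mD (integrableZl mD c1 f2)
    (integrableZl mD c2 f1))) => t _ /=.
  by case: (f t) => a b /=; rewrite -EFinM -EFinM -EFinD.
Qed.

Lemma cintegralZ D (c : R[i]) f : measurable D ->
  cintegrable mu D f ->
  cintegral mu D (fun t => c * f t) = c * cintegral mu D f.
Proof.
case: c => c1 c2 mD [f1 f2].
have i11 := integrableZl mD c1 f1; have i12 := integrableZl mD c1 f2.
have i21 := integrableZl mD c2 f1; have i22 := integrableZl mD c2 f2.
rewrite /cintegral -[RHS]/((_ - _) +i* (_ + _)) -!RintegralZl//.
rewrite -RintegralB// -RintegralD//; congr (_ +i* _).
- by apply: eq_Rintegral => t _; case: (f t).
- by apply: eq_Rintegral => t _; case: (f t).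
Qed.

Lemma cintegral_conj D f : measurable D -> cintegrable mu D f ->
  cintegral mu D (fun t => conjc (f t)) = conjc (cintegral mu D f).
Proof.
move=> mD [f1 f2]; rewrite /cintegral /=; congr (_ +i* _).
- by apply: eq_Rintegral => t _; case: (f t).
- rewrite -mulN1r -RintegralZl//; apply: eq_Rintegral => t _.
  by case: (f t) => a b /=; rewrite mulN1r.
Qed.

Lemma ae_eq_cintegral D f g : measurable D ->
  cintegrable mu D f -> cintegrable mu D g ->
  f = g %[ae mu in D] -> cintegral mu D f = cintegral mu D g.
Proof.
move=> mD [f1 f2] [g1 g2] fg; rewrite /cintegral /Rintegral.
congr (fine _ +i* fine _); apply: ae_eq_integral => //.
- exact: measurable_int f1.
- exact: measurable_int g1.
- by apply: filterS fg => t /[apply] ->.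
- exact: measurable_int f2.
- exact: measurable_int g2.
- by apply: filterS fg => t /[apply] ->.
Qed.

Lemma eq_cintegral D f g : {in D, f =1 g} ->
  cintegral mu D f = cintegral mu D g.
Proof.
by move=> fg; congr (_ +i* _); apply: eq_Rintegral => t Dt; rewrite fg.
Qed.

(** Change of variables: the left side integrates [f] against the pushforward of [mu] by [h], which
    agrees with [mu] on measurable sets. *)
Lemma measure_preserving_integral (h : T -> T) (f : T -> R) :
  measure_preserving mu h -> measurable_fun setT f ->
  mu.-integrable setT (EFin \o (f \o h)) ->
  \int[mu]_t f (h t) = \int[mu]_t f t.
Proof.
move=> [mh hP] mf intf; rewrite /Rintegral; congr fine.
rewrite -[LHS]/(\int[mu]_t (EFin \o f \o h) t)%E.
rewrite -[X in (integral mu X _)](preimage_setT h).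
rewrite -(integral_pushforward mh) //; last first.
- exact/measurable_EFinP.
apply: eq_measure_integral => // A mA _; exact: hP.
Qed.

Lemma measure_preserving_integrable (h : T -> T) (f : T -> R) :
  measure_preserving mu h ->
  mu.-integrable setT (EFin \o f) -> mu.-integrable setT (EFin \o (f \o h)).
Proof.
move=> [mh hP] /integrableP[mf fi]; apply/integrableP; split.
  exact: measurableT_comp mf mh.
rewrite -[X in (integral mu X _)](preimage_setT h).
rewrite -[X in (X < _)%E]/(\int[mu]_(t in h @^-1` setT)
  ((fun s => `|(f s)%:E|) \o h) t)%E.
rewrite -(ge0_integral_pushforward mh)//; last exact: measurableT_comp.
by rewrite (eq_measure_integral mu) // => A mA _; exact: hP.
Qed.

Lemma measure_preserving_cintegral (h : T -> T) (f : T -> R[i]) :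
  measure_preserving mu h -> cintegrable mu setT f ->
  cintegral mu setT (f \o h) = cintegral mu setT f.
Proof.
move=> hP [f1 f2]; rewrite /cintegral; congr (_ +i* _).
- apply: (measure_preserving_integral hP).
    exact/measurable_EFinP/(measurable_int mu f1).
  exact: (measure_preserving_integrable hP f1).
- apply: (measure_preserving_integral hP).
    exact/measurable_EFinP/(measurable_int mu f2).
  exact: (measure_preserving_integrable hP f2).
Qed.

Lemma measure_preserving_ae_eq (h : T -> T) U (f g : T -> U) :
  measure_preserving mu h -> f = g %[ae mu] -> f \o h = g \o h %[ae mu].
Proof.
move=> [mh hP] [N [mN N0 fgN]]; exists (h @^-1` N); split.
- by rewrite -[X in measurable X]setTI; exact: mh.
- by rewrite hP.
- by move=> t /= tN; apply: fgN => /= fgt; apply: tN => _; exact: fgt.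
Qed.

End complex_integral_theory.

(** * The space L2 *)

(** The squared modulus as a real number; the norm on [R[i]] takes its values in [R[i]]. *)
Definition sqmod (R : realType) (z : R[i]) : R :=
  complex.Re z ^+ 2 + complex.Im z ^+ 2.

Lemma sqmod_ge0 (R : realType) (z : R[i]) : 0 <= sqmod z.
Proof. by rewrite addr_ge0 ?sqr_ge0. Qed.

Lemma sqmodM (R : realType) (z w : R[i]) : sqmod (z * w) = sqmod z * sqmod w.
Proof. by case: z w => [a b] [a' b']; rewrite /sqmod /=; ring. Qed.

Lemma sqmod_conj (R : realType) (z : R[i]) : sqmod (conjc z) = sqmod z.
Proof. by case: z => [a b]; rewrite /sqmod /= sqrrN. Qed.

Lemma mulC_conj (R : realType) (z : R[i]) : z * conjc z = (sqmod z)%:C.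
Proof.
by case: z => [a b]; rewrite /sqmod; apply/eqP; rewrite eq_complex /=;
  apply/andP; split; apply/eqP; ring.
Qed.

Lemma sqmodD_le (R : realType) (z w : R[i]) :
  sqmod (z + w) <= 2 * sqmod z + 2 * sqmod w.
Proof.
case: z w => [a b] [a' b']; rewrite -subr_ge0 /sqmod /=.
rewrite (_ : _ - _ = (a - a') ^+ 2 + (b - b') ^+ 2); last by ring.
by rewrite addr_ge0 ?sqr_ge0.
Qed.

Lemma Lfun2_sqr d (T : measurableType d) (R : realType)
    (mu : {measure set T -> \bar R}) (f : T -> R) :
  measurable_fun setT f ->
  mu.-integrable setT (fun t => (f t ^+ 2)%:E) -> f \in Lfun mu 2%:E.
Proof.
move=> mf /integrableP[_ fi].
rewrite inE; apply/andP; split; rewrite inE//= /finite_norm.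
rewrite unlock poweR_lty//; move: fi; apply: le_lt_trans.
rewrite le_eqVlt; apply/orP; left; apply/eqP.
apply: eq_integral => t _ /=; rewrite powR_mulrn//.
by rewrite normrX.
Qed.

Section square_integrable.
Context (R : realType) (d : nat).
Local Notation leb := (lebesgue_n R d).
Implicit Types (f g h u v : fct R d).

Definition measurable_fct f : Prop :=
  measurable_fun setT (fun t => complex.Re (f t)) /\
  measurable_fun setT (fun t => complex.Im (f t)).

Lemma measurable_fctM f g : measurable_fct f -> measurable_fct g ->
  measurable_fct (fun t => f t * g t).
Proof.
move=> [f1 f2] [g1 g2]; split.
- apply: eq_measurable_fun
    (measurable_funB (measurable_funM f1 g1) (measurable_funM f2 g2)) => t _ /=.
  by case: (f t) (g t) => [a b] [a' b'].
- apply: eq_measurable_fun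
    (measurable_funD (measurable_funM f1 g2) (measurable_funM f2 g1)) => t _ /=.
  by case: (f t) (g t) => [a b] [a' b'].
Qed.

Lemma measurable_fctD f g : measurable_fct f -> measurable_fct g ->
  measurable_fct (fun t => f t + g t).
Proof.
move=> [f1 f2] [g1 g2]; split.
- apply: eq_measurable_fun (measurable_funD f1 g1) => t _ /=.
  by case: (f t) (g t) => [a b] [a' b'].
- apply: eq_measurable_fun (measurable_funD f2 g2) => t _ /=.
  by case: (f t) (g t) => [a b] [a' b'].
Qed.

Lemma measurable_fct_conj f : measurable_fct f ->
  measurable_fct (fun t => conjc (f t)).
Proof.
move=> [f1 f2]; split.
- by apply: eq_measurable_fun f1 => t _; case: (f t).
- by apply: eq_measurable_fun (measurable_funN f2) => t _ /=; case: (f t).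
Qed.

Lemma measurable_fct_cst (c : R[i]) : measurable_fct (fun=> c).
Proof. by split; exact: measurable_cst. Qed.

Lemma L2_measurable f : L2 f -> measurable_fct f.
Proof.
by case=> /[!inE] /andP[/[!inE]/= f1 _] /andP[/[!inE]/= f2 _].
Qed.

Lemma L2_integrable_sqmod f : L2 f ->
  leb.-integrable setT (fun t => (sqmod (f t))%:E).
Proof.
case=> /Lfun2_integrable_sqr f1 /Lfun2_integrable_sqr f2.
by have := integrableD measurableT f1 f2.
Qed.

(** The working criterion for membership in L^2: the squares of the real and imaginary parts both
    lie below [sqmod (f t)], hence below [h]. *)
Lemma L2_dominated f (h : Rn R d -> R) : measurable_fct f ->
  leb.-integrable setT (EFin \o h) -> (forall t, sqmod (f t) <= h t) -> L2 f.
Proof.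
move=> [f1 f2] hi fh; split; apply: Lfun2_sqr => //.
- apply: le_integrable hi => //; first exact/measurable_EFinP/measurable_funX.
  move=> t _ /=; rewrite lee_fin ger0_norm ?sqr_ge0//.
  by apply: le_trans (ler_norm _); apply: le_trans (fh t);
    rewrite lerDl sqr_ge0.
- apply: le_integrable hi => //; first exact/measurable_EFinP/measurable_funX.
  move=> t _ /=; rewrite lee_fin ger0_norm ?sqr_ge0//.
  by apply: le_trans (ler_norm _); apply: le_trans (fh t);
    rewrite lerDr sqr_ge0.
Qed.

Lemma L2_lincomb (c : R[i]) f g : L2 f -> L2 g -> L2 (fun t => c * f t + g t).
Proof.
move=> fL gL; have mf := L2_measurable fL; have mg := L2_measurable gL.
apply: (@L2_dominated _
  (fun t => 2 * sqmod c * sqmod (f t) + 2 * sqmod (g t))).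
- by apply: measurable_fctD => //; apply: measurable_fctM => //;
    exact: measurable_fct_cst.
- have fi := integrableZl measurableT (2 * sqmod c) (L2_integrable_sqmod fL).
  have gi := integrableZl measurableT 2 (L2_integrable_sqmod gL).
  by have := integrableD measurableT fi gi.
- move=> t; apply: le_trans (sqmodD_le _ _) _.
  by rewrite sqmodM mulrA.
Qed.

Lemma L2_0 : @L2 R d (fun=> 0).
Proof.
apply: (@L2_dominated _ (cst 0)); first exact: measurable_fct_cst.
  exact: integrable0.
by move=> t; rewrite /sqmod /= expr0n addr0.
Qed.

Lemma L2Z (c : R[i]) f : L2 f -> L2 (fun t => c * f t).
Proof.
move=> fL; rewrite (_ : (fun t => _) = fun t => c * f t + (fun=> 0) t).
  by apply: L2_lincomb => //; exact: L2_0.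
by apply/funext => t; rewrite addr0.
Qed.

Lemma L2B f g : L2 f -> L2 g -> L2 (fun t => f t - g t).
Proof.
move=> fL gL; rewrite (_ : (fun t => _) = fun t => -1 * g t + f t).
  exact: L2_lincomb.
by apply/funext => t; rewrite mulN1r addrC.
Qed.

Lemma L2_sum (c : nat -> R[i]) (e : nat -> fct R d) n :
  (forall k, L2 (e k)) -> L2 (fun t => \sum_(k < n) c k * e k t).
Proof.
move=> eL; elim: n => [|n IH].
  rewrite (_ : (fun t => _) = fun=> 0); first exact: L2_0.
  by apply/funext => t; rewrite big_ord0.
rewrite (_ : (fun t => _) = fun t => c n * e n t + \sum_(k < n) c k * e k t).
  exact: L2_lincomb.
by apply/funext => t; rewrite big_ord_recr /= addrC.
Qed.

(** Hoelder's inequality makes the four products of real and imaginary parts integrable. *)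
Lemma inner_integrable f g : L2 f -> L2 g ->
  cintegrable leb setT (fun t => f t * conjc (g t)).
Proof.
case=> f1 f2 [g1 g2].
have /Lfun1_integrable i11 := Lfun2_mul_Lfun1 f1 g1.
have /Lfun1_integrable i12 := Lfun2_mul_Lfun1 f1 g2.
have /Lfun1_integrable i21 := Lfun2_mul_Lfun1 f2 g1.
have /Lfun1_integrable i22 := Lfun2_mul_Lfun1 f2 g2.
split.
- apply: (eq_integrable measurableT _ _ _ (integrableD measurableT i11 i22)).
  move=> t _ /=; case: (f t) (g t) => [a b] [a' b'] /=.
  by rewrite -EFinD mulrN opprK.
- apply: (eq_integrable measurableT _ _ _ (integrableB measurableT i21 i12)).
  move=> t _ /=; case: (f t) (g t) => [a b] [a' b'] /=.
  by rewrite -EFinB mulrN addrC.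
Qed.

Lemma inner_lincomb (c : R[i]) f g h : L2 f -> L2 g -> L2 h ->
  inner (fun t => c * f t + g t) h = c * inner f h + inner g h.
Proof.
move=> fL gL hL; have fh := inner_integrable fL hL.
have gh := inner_integrable gL hL.
rewrite /inner -cintegralZ// -cintegralD//; last exact: cintegrableZ.
by apply: eq_cintegral => t _; rewrite mulrDl mulrA.
Qed.

Lemma inner_conj f g : L2 f -> L2 g -> inner g f = conjc (inner f g).
Proof.
move=> fL gL; rewrite /inner -cintegral_conj//; last exact: inner_integrable.
apply: eq_cintegral => t _; case: (f t) (g t) => [a b] [a' b'].
by apply/eqP; rewrite eq_complex /=; apply/andP; split; apply/eqP; ring.
Qed.

Lemma inner0l g : inner (fun=> 0) g = 0.
Proof.
rewrite /inner /cintegral.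
rewrite (_ : (fun t => complex.Re _) = cst 0); last first.
  by apply/funext => t /=; rewrite mul0r.
rewrite (_ : (fun t => complex.Im _) = cst 0); last first.
  by apply/funext => t /=; rewrite mul0r.
by rewrite Rintegral_cst// mul0r.
Qed.

Lemma innerZl (c : R[i]) f h : L2 f -> L2 h ->
  inner (fun t => c * f t) h = c * inner f h.
Proof.
move=> fL hL; have := inner_lincomb c fL L2_0 hL; rewrite inner0l addr0 => <-.
by congr inner; apply/funext => t; rewrite addr0.
Qed.

Lemma innerBl f g h : L2 f -> L2 g -> L2 h ->
  inner (fun t => f t - g t) h = inner f h - inner g h.
Proof.
move=> fL gL hL; rewrite -mulN1r addrC -inner_lincomb//.
by congr inner; apply/funext => t; rewrite mulN1r addrC.
Qed.

Lemma innerZr (c : R[i]) f h : L2 f -> L2 h ->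
  inner f (fun t => c * h t) = conjc c * inner f h.
Proof.
move=> fL hL; rewrite (inner_conj (L2Z c hL) fL) innerZl// rmorphM.
by rewrite (inner_conj hL fL).
Qed.

Lemma innerBr f g h : L2 f -> L2 g -> L2 h ->
  inner h (fun t => f t - g t) = inner h f - inner h g.
Proof.
move=> fL gL hL; rewrite (inner_conj (L2B fL gL) hL) innerBl// rmorphB.
by rewrite (inner_conj fL hL) (inner_conj gL hL).
Qed.

Lemma inner_suml (c : nat -> R[i]) (e : nat -> fct R d) n h :
  (forall k, L2 (e k)) -> L2 h ->
  inner (fun t => \sum_(k < n) c k * e k t) h =
    \sum_(k < n) c k * inner (e k) h.
Proof.
move=> eL hL; elim: n => [|n IH].
  rewrite big_ord0 -[RHS](inner0l h); congr inner.
  by apply/funext => t; rewrite big_ord0.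
rewrite big_ord_recr /= -IH addrC -inner_lincomb//; last exact: L2_sum.
by congr inner; apply/funext => t; rewrite big_ord_recr /= addrC.
Qed.

Lemma ae_eq_inner f f' g g' : L2 f -> L2 f' -> L2 g -> L2 g' ->
  f = f' %[ae leb] -> g = g' %[ae leb] -> inner f g = inner f' g'.
Proof.
move=> fL fL' gL gL' ff' gg'; apply: ae_eq_cintegral => //.
- exact: inner_integrable.
- exact: inner_integrable.
- by apply: filterS2 ff' gg' => t + + Dt => /(_ Dt) -> /(_ Dt) ->.
Qed.

Lemma inner_self f : L2 f -> inner f f = (L2norm f ^+ 2)%:C.
Proof.
move=> fL; rewrite /L2norm sqr_sqrtr.
  apply/eqP; rewrite eq_complex /= eqxx /=; apply/eqP.
  rewrite (_ : (fun t => complex.Im _) = cst 0).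
    by rewrite Rintegral_cst// mul0r.
  by apply/funext => t /=; rewrite mulC_conj.
by apply: Rintegral_ge0 => t _; rewrite mulC_conj; exact: sqmod_ge0.
Qed.

Lemma Re_inner_self f : L2 f -> complex.Re (inner f f) = L2norm f ^+ 2.
Proof. by move=> fL; rewrite inner_self. Qed.

Lemma L2norm_ge0 f : 0 <= L2norm f. Proof. exact: sqrtr_ge0. Qed.

Lemma L2norm_sqr f : L2 f -> L2norm f ^+ 2 = \int[leb]_t sqmod (f t).
Proof.
move=> fL; rewrite -Re_inner_self//.
by apply: eq_Rintegral => t _; rewrite mulC_conj.
Qed.

(** A nonnegative function with zero integral vanishes almost everywhere; here the function is
    |f|^2. *)
Lemma L2norm_eq0 f : L2 f -> L2norm f = 0 -> f = (fun=> 0) %[ae leb].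
Proof.
move=> fL f0; have fi := L2_integrable_sqmod fL.
have int0 : (\int[leb]_t (sqmod (f t))%:E = 0)%E.
  rewrite -[LHS]fineK; last exact: integrable_fin_num.
  by rewrite -[fine _](L2norm_sqr fL) f0 expr0n.
have : (\int[leb]_t `|(sqmod (f t))%:E| = 0)%E.
  rewrite -[RHS]int0; apply: eq_integral => t _.
  by rewrite gee0_abs// lee_fin sqmod_ge0.
move/ae_eq_integral_abs => /(_ measurableT).
move=> /(_ (measurable_int leb fi)).
apply: filterS => t /[apply] -[] /eqP.
rewrite paddr_eq0 ?sqr_ge0// !sqrf_eq0 => /andP[/eqP Re0 /eqP Im0].
by apply/eqP; rewrite eq_complex Re0 Im0 !eqxx.
Qed.

Lemma ae_eq_L2norm f g : L2 f -> L2 g -> f = g %[ae leb] ->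
  L2norm f = L2norm g.
Proof. by move=> fL gL fg; rewrite /L2norm (ae_eq_inner fL gL fL gL). Qed.

Lemma L2normZ (c : R[i]) f : L2 f ->
  L2norm (fun t => c * f t) = Num.sqrt (sqmod c) * L2norm f.
Proof.
move=> fL; rewrite {1}/L2norm innerZl//; last exact: L2Z.
rewrite innerZr// inner_self// mulrA mulC_conj.
rewrite -rmorphM /= sqrtrM ?sqmod_ge0// sqrtr_sqr ger0_norm// L2norm_ge0//.
Qed.

Lemma Cauchy_Schwarz f g : L2 f -> L2 g ->
  sqmod (inner f g) <= L2norm f ^+ 2 * L2norm g ^+ 2.
Proof.
move=> fL gL; set q := sqmod _; set a := L2norm f ^+ 2; set b := L2norm g ^+ 2.
(* [key] is 0 <= |f - t <f, g> g|^2. *)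
have key (t : R) : 0 <= a - 2 * t * q + t ^+ 2 * q * b.
  pose c := t%:C * inner f g.
  have cgL : L2 (fun s => c * g s) by exact: L2Z.
  have := sqr_ge0 (L2norm (fun s => f s - c * g s)).
  rewrite -Re_inner_self; last exact: L2B.
  rewrite innerBl// ?innerBr//; [|exact: L2B..].
  rewrite !innerZl// !innerZr// !inner_self// (inner_conj fL gL) -/a -/b /c.
  rewrite /q /sqmod; case: (inner f g) => x y /=.
  by rewrite (_ : _ - _ = a - 2 * t * (x ^+ 2 + y ^+ 2) +
    t ^+ 2 * (x ^+ 2 + y ^+ 2) * b) //; ring.
have q0 : 0 <= q by exact: sqmod_ge0.
have a0 : 0 <= a by exact: sqr_ge0.
have : 0 <= b by exact: sqr_ge0.
rewrite le_eqVlt => /predU1P[b0|b0].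
  rewrite -b0 mulr0; rewrite leNgt; apply/negP => q_gt0.
  (* When b = 0 the polynomial is affine with slope -2q; this choice of t gives it the value -1. *)
  have := key ((a + 1) / (2 * q)); rewrite -b0 mulr0 addr0.
  rewrite (_ : 2 * _ * q = a + 1); last by field; rewrite gt_eqF.
  lra.
(* The minimum of the quadratic polynomial is at t = 1/b, with value a - q/b. *)
have := key b^-1.
rewrite (_ : _ + _ = a - q / b); last by field; rewrite gt_eqF.
by rewrite subr_ge0 ler_pdivrMr.
Qed.

Lemma normc_inner_le f g : L2 f -> L2 g ->
  `|inner f g| <= (L2norm f * L2norm g)%:C.
Proof.
move=> fL gL; rewrite normc_def lecR -[leRHS]ger0_norm; last first.
  by rewrite mulr_ge0 ?L2norm_ge0.
by rewrite -sqrtr_sqr ler_wsqrtr// exprMn; exact: Cauchy_Schwarz.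
Qed.

End square_integrable.

(** * Traces, adjoints and rank one operators *)

Lemma ccvg_dominated (R : realType) (u : nat -> R[i]) (l : R[i])
    (v : nat -> R) :
  (forall n, `|l - u n| <= (v n)%:C) -> v @ \oo --> (0 : R) -> ccvg u l.
Proof.
move=> uv v0; apply/cvgrPdist_lt => /= e.
(* A positive element of [R[i]] has zero imaginary part, so the radius [e] is a real number in
   disguise. *)
rewrite ltcE /= => /andP[/eqP Im0 Re_gt0].
move/cvgrPdist_lt : v0 => /(_ _ Re_gt0); apply: filterS => n.
rewrite sub0r normrN => vn; apply: le_lt_trans (uv n) _.
by rewrite ltcE /= Im0 eqxx /=; exact: le_lt_trans (ler_norm _) vn.
Qed.

Lemma ccvg_unique (R : realType) (u : nat -> R[i]) (l l' : R[i]) :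
  ccvg u l -> ccvg u l' -> l = l'.
Proof. exact: (@cvg_unique _ (@norm_hausdorff R[i] R[i]^o)). Qed.

Section traces.
Context (R : realType) (d : nat).
Local Notation leb := (lebesgue_n R d).
Implicit Types (f g h u v psi : fct R d) (e : nat -> fct R d) (A B : oper R d).

(* [trace] is an [xget] over all bases: it is meaningful only once its value is
   shown to be the same in each of them. *)
Lemma trace_unique A (t : R[i]) : (exists e, orthonormal_basis e) ->
  (forall e, orthonormal_basis e ->
     ccvg (fun n => \sum_(k < n) inner (A (e k)) (e k)) t) ->
  trace A = t.
Proof.
move=> [e0 e0P] At.
have [e eP tr] : is_trace A (trace A).
  apply: (@xgetPex _ 0 [set s | is_trace A s]).
  by exists t, e0 => //; exact: At.
exact: ccvg_unique tr (At e eP).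
Qed.

(** The partial sums are <s_n, u> with s_n the truncated expansion of [v]; by Cauchy-Schwarz the
    error is at most |v - s_n| |u|. *)
Lemma parseval e u v : orthonormal_basis e -> L2 u -> L2 v ->
  ccvg (fun n => \sum_(k < n) inner v (e k) * inner (e k) u) (inner v u).
Proof.
move=> [eL _ ee] uL vL.
apply: (@ccvg_dominated _ _ _ (fun n => L2norm
   (fun t => v t - \sum_(k < n) inner v (e k) * e k t) * L2norm u)).
  move=> n; rewrite -(inner_suml (fun k => inner v (e k)))//.
  have sL := L2_sum (fun k => inner v (e k)) n eL.
  by rewrite -innerBl//; apply: normc_inner_le => //; exact: L2B.
by rewrite -[X in _ --> X](mul0r (L2norm u)); apply: cvgMl; exact: ee.
Qed.

(** In any basis the diagonal sum is a Parseval sum for <v, u>. The shape of [A] is asked only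
    almost everywhere, because [bounded_op] gives homogeneity only almost everywhere. *)
Lemma trace_of_rank_one A u v :
  (exists e : nat -> fct R d, orthonormal_basis e) ->
  L2 u -> L2 v -> (forall f, L2 f -> L2 (A f)) ->
  (forall f, L2 f -> A f = (fun t => inner f u * v t) %[ae leb]) ->
  trace A = inner v u.
Proof.
move=> eX uL vL AL Auv; apply: trace_unique => // e eP.
have eL := onb_L2 eP.
rewrite (_ : (fun n => _) =
    fun n => \sum_(k < n) inner v (e k) * inner (e k) u).
  exact: parseval.
apply/funext => n; apply: eq_bigr => k _.
rewrite (ae_eq_inner _ (L2Z (inner (e k) u) vL) (eL k) (eL k) (Auv _ (eL k))
  (ae_eq_refl _ _ _)); first by rewrite innerZl// mulrC.
exact: AL.
Qed.

Lemma bounded_op_sum A e (c : nat -> R[i]) n : bounded_op A ->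
  (forall k, L2 (e k)) ->
  A (fun t => \sum_(k < n) c k * e k t) =
    (fun t => \sum_(k < n) c k * A (e k) t) %[ae leb].
Proof.
move=> Ab eL; elim: n => [|n IH].
  (* Linearity at -1 * 0 + 0 gives A 0 = - A 0 + A 0 = 0 almost everywhere. *)
  have := bounded_op_linear Ab (-1) (@L2_0 R d) (@L2_0 R d).
  rewrite (_ : (fun t => -1 * (fun=> 0) t + (fun=> 0) t) = fun=> 0); last first.
    by apply/funext => t /=; rewrite mulr0 addr0.
  rewrite (_ : (fun t => \sum_(k < 0) c k * e k t) = fun=> 0); last first.
    by apply/funext => t; rewrite big_ord0.
  by apply: filterS => t /[apply] ->; rewrite big_ord0 mulN1r addNr.
rewrite (_ : (fun t => \sum_(k < n.+1) c k * e k t) =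
    fun t => c n * e n t + \sum_(k < n) c k * e k t); last first.
  by apply/funext => t; rewrite big_ord_recr /= addrC.
have := bounded_op_linear Ab (c n) (eL n) (L2_sum c n eL).
apply: filterS2 IH => t /[swap] + + Dt => /(_ Dt) -> /(_ Dt) ->.
by rewrite big_ord_recr /= addrC.
Qed.

(** With the rank one factor on the left, the partial sums are <A s_n, psi>, where s_n is the
    truncated expansion of [psi]. Boundedness of [A] gives the limit directly, without writing the
    composite by means of the adjoint of [A]. *)
Lemma trace_rank_one_comp A psi :
  (exists e : nat -> fct R d, orthonormal_basis e) ->
  bounded_op A -> L2 psi -> trace (rank_one psi \o A) = inner (A psi) psi.
Proof.
move=> eX Ab pL; apply: trace_unique => // e eP; have [eL _ ee] := eP.
have AL := bounded_op_L2 Ab.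
have [M AM] := bounded_op_bounded Ab.
pose s n : fct R d := fun t => \sum_(k < n) inner psi (e k) * e k t.
have sL n : L2 (s n) by exact: (L2_sum (fun k => inner psi (e k))).
apply: (@ccvg_dominated _ _ _ (fun n => L2norm
   (A (fun t => psi t - s n t)) * L2norm psi)).
  move=> n; rewrite (_ : \sum_(k < n) _ = inner (A (s n)) psi); last first.
    rewrite (ae_eq_inner (AL _ (sL n))
      (L2_sum (fun k => inner psi (e k)) n (fun k => AL _ (eL k))) pL pL
      (bounded_op_sum _ n Ab eL) (ae_eq_refl _ _ _)).
    rewrite (inner_suml (fun k => inner psi (e k)) n (fun k => AL _ (eL k)) pL).
    apply: eq_bigr => k _; rewrite /= /rank_one innerZl//.
    by rewrite mulrC.
  have lin : A (fun t => psi t - s n t) =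
      (fun t => A psi t - A (s n) t) %[ae leb].
    have := bounded_op_linear Ab (-1) (sL n) pL.
    rewrite (_ : (fun t => _ + _) = fun t => psi t - s n t); last first.
      by apply/funext => t; rewrite mulN1r addrC.
    by apply: filterS => t /[apply] ->; rewrite mulN1r addrC.
  rewrite (ae_eq_L2norm (AL _ (L2B pL (sL n)))
    (L2B (AL _ pL) (AL _ (sL n))) lin).
  rewrite -innerBl//; [|exact: AL..].
  by apply: normc_inner_le => //; apply: L2B; exact: AL.
rewrite -[X in _ --> X](mul0r (L2norm psi)); apply: cvgMl.
apply: (@squeeze_cvgr _ _ _ _ (fun=> 0)
  (fun n => M * L2norm (fun t => psi t - s n t))).
- by apply: nearW => n; rewrite L2norm_ge0 AM//; exact: L2B.
- exact: cvg_cst.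
- by rewrite -[X in _ --> X](mulr0 M); apply: cvgMr; exact: ee.
Qed.

Lemma bounded_opZ A (c : R[i]) f : bounded_op A -> L2 f ->
  A (fun t => c * f t) = (fun t => c * A f t) %[ae leb].
Proof.
move=> Ab fL; have := bounded_op_sum (fun=> c) 1 Ab (fun=> fL).
rewrite (_ : (fun t => \sum_(k < 1) c * f t) = fun t => c * f t); last first.
  by apply/funext => t; rewrite big_ord1.
by apply: filterS => t /[apply] ->; rewrite big_ord1.
Qed.

Lemma bounded_op_comp A B : bounded_op A -> bounded_op B -> bounded_op (A \o B).
Proof.
move=> [AL Aae Alin [M AM]] [BL Bae Blin [N BN]]; split.
- by move=> f fL; apply: AL; exact: BL.
- by move=> f g fL gL fg; apply: Aae; [exact: BL..|exact: Bae].
- move=> c f g fL gL /=.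
  apply: ae_eq_trans (Alin c _ _ (BL _ fL) (BL _ gL)).
  apply: Aae; [exact/BL/L2_lincomb| |exact: Blin].
  by apply: L2_lincomb; exact: BL.
(* The bound [M] is not known to be nonnegative; the maximum with 0 allows multiplying the bound for
   [B] by it. *)
- exists (Num.max M 0 * N) => f fL /=.
  apply: le_trans (AM _ (BL _ fL)) _; rewrite -mulrA.
  apply: (@le_trans _ _ (Num.max M 0 * L2norm (B f))).
    by rewrite ler_wpM2r ?L2norm_ge0// le_max lexx.
  by rewrite ler_wpM2l// ?BN// le_max lexx orbT.
Qed.

Definition adjoint_pair A B : Prop :=
  forall f g, L2 f -> L2 g -> inner (A f) g = inner f (B g).

(** The witness [B] shows that the choice in [adjoint] is not the default. The difference d of the
    two candidates at f satisfies <d, d> = <A d, f> - <A d, f> = 0. *)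
Lemma adjointE A B : (forall f, L2 f -> L2 (A f)) ->
  bounded_op B -> adjoint_pair A B ->
  [/\ bounded_op (adjoint A), adjoint_pair A (adjoint A) &
    forall f, L2 f -> adjoint A f = B f %[ae leb]].
Proof.
move=> AL Bb AB.
have [B'b AB'] : bounded_op (adjoint A) /\ adjoint_pair A (adjoint A).
  exact: (@xgetPex _ (fun f => f) [set B | bounded_op B /\ adjoint_pair A B]
    (ex_intro _ B (conj Bb AB))).
split=> // f fL.
have BL := bounded_op_L2 Bb fL; have BL' := bounded_op_L2 B'b fL.
have dL := L2B BL' BL.
have : L2norm (fun t => adjoint A f t - B f t) = 0.
  apply/eqP; rewrite -sqrf_eq0 -Re_inner_self// innerBr//.
  by rewrite -AB// -AB'// subrr.
move/(L2norm_eq0 dL); apply: filterS => t /[apply] /eqP.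
by rewrite subr_eq0 => /eqP.
Qed.

Lemma bounded_rank_one psi : L2 psi -> bounded_op (rank_one psi).
Proof.
move=> pL; split.
- by move=> f fL; exact: L2Z.
- move=> f g fL gL fg; rewrite /rank_one.
  rewrite (ae_eq_inner fL gL pL pL fg (ae_eq_refl _ _ _)).
  exact: ae_eq_refl.
- move=> c f g fL gL; apply: aeW => t _; rewrite /rank_one inner_lincomb//.
  by rewrite mulrDl mulrA.
- exists (L2norm psi * L2norm psi) => f fL; rewrite L2normZ// mulrAC.
  rewrite ler_wpM2r ?L2norm_ge0// -[leRHS]ger0_norm; last first.
    by rewrite mulr_ge0 ?L2norm_ge0.
  rewrite -sqrtr_sqr ler_wsqrtr// mulrC exprMn; exact: Cauchy_Schwarz.
Qed.

Lemma rank_one_adjoint psi : L2 psi ->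
  adjoint_pair (rank_one psi) (rank_one psi).
Proof.
move=> pL f g fL gL; rewrite /rank_one innerZl// innerZr//.
by rewrite -inner_conj// mulrC.
Qed.

Lemma positive_rank_one psi : L2 psi -> positive_op (rank_one psi).
Proof.
move=> pL f fL; rewrite /rank_one innerZl// (inner_conj fL pL).
exact: mulcJ_ge0.
Qed.

(** A positive self-adjoint operator is its own absolute value, and its diagonal sums converge by
    Parseval. *)
Lemma trace_class_rank_one psi :
  (exists e : nat -> fct R d, orthonormal_basis e) ->
  L2 psi -> L2norm psi = 1 -> trace_class (rank_one psi).
Proof.
move=> [e eP] pL p1; have pb := bounded_rank_one pL; split=> //.
have pLL := bounded_op_L2 pb.
have [_ _ adjP] := adjointE pLL pb (rank_one_adjoint pL).
exists (rank_one psi); split=> //.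
- exact: positive_rank_one.
- move=> f fL; apply: ae_eq_sym; exact/adjP/pLL.
- exists (inner psi psi), e => //; have eL := onb_L2 eP.
  rewrite (_ : (fun n => _) =
      fun n => \sum_(k < n) inner psi (e k) * inner (e k) psi).
    exact: parseval.
  apply/funext => n; apply: eq_bigr => k _.
  by rewrite /rank_one innerZl// mulrC.
Qed.

End traces.

(** * Time-frequency shifts *)

Section weighted_composition.
Context (R : realType) (d : nat).
Local Notation leb := (lebesgue_n R d).
Implicit Types (f k : fct R d).

(** Common form of pi(z), P and the explicit adjoint of pi(z): a unimodular weight times composition
    with a measure preserving map. *)
Definition weighted_comp (m : fct R d) (g : Rn R d -> Rn R d) : oper R d :=
  fun f t => m t * f (g t).

Variables (m : fct R d) (g : Rn R d -> Rn R d).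
Hypothesis mm : measurable_fct m.
Hypothesis m1 : forall t, sqmod (m t) = 1.
Hypothesis gP : measure_preserving leb g.

Lemma L2_weighted_comp f : L2 f -> L2 (weighted_comp m g f).
Proof.
move=> fL; have [f1 f2] := L2_measurable fL; have [mg _] := gP.
apply: (@L2_dominated _ _ _ ((fun t => sqmod (f t)) \o g)).
- apply: measurable_fctM => //.
  by split; [exact: (measurableT_comp f1 mg)|exact: (measurableT_comp f2 mg)].
- exact: (measure_preserving_integrable gP (L2_integrable_sqmod fL)).
- by move=> t; rewrite sqmodM m1 mul1r.
Qed.

Lemma inner_weighted_comp f k : L2 f -> L2 k ->
  inner (weighted_comp m g f) (weighted_comp m g k) = inner f k.
Proof.
move=> fL kL.
rewrite -[RHS](measure_preserving_cintegral gP (inner_integrable fL kL)).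
apply: eq_cintegral => t _ /=; rewrite /weighted_comp rmorphM.
by rewrite mulrACA mulC_conj m1 mul1r.
Qed.

Lemma bounded_weighted_comp : bounded_op (weighted_comp m g).
Proof.
split.
- exact: L2_weighted_comp.
- move=> f k fL kL /(measure_preserving_ae_eq gP).
  by apply: filterS => t /[apply] /= fk; rewrite /weighted_comp fk.
- move=> c f k fL kL; apply: aeW => t _; rewrite /weighted_comp.
  by rewrite mulrDr mulrCA.
- by exists 1 => f fL; rewrite mul1r /L2norm inner_weighted_comp.
Qed.

Variable h : Rn R d -> Rn R d.
Hypothesis hP : measure_preserving leb h.
Hypothesis hK : cancel h g.

(** Substituting h t for t in the integral turns g (h t) into t and moves [h] onto the second
    argument. *)
Lemma weighted_comp_adjoint : adjoint_pair (weighted_comp m g)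
  (weighted_comp (fun t => conjc (m (h t))) h).
Proof.
move=> f k fL kL; rewrite /inner.
rewrite -(measure_preserving_cintegral hP); last first.
  by apply: inner_integrable => //; exact: L2_weighted_comp.
apply: eq_cintegral => t _; rewrite /weighted_comp /= hK.
case: (m (h t)) (f t) (k (h t)) => [a b] [a' b'] [a'' b''].
by apply/eqP; rewrite eq_complex /=; apply/andP; split; apply/eqP; ring.
Qed.

Lemma measurable_weight_adjoint : measurable_fct (fun t => conjc (m (h t))).
Proof.
apply: measurable_fct_conj; have [a1 a2] := mm; have [mh _] := hP.
by split; [exact: (measurableT_comp a1 mh)|exact: (measurableT_comp a2 mh)].
Qed.

End weighted_composition.

(** * The unitaries pi(z) and P, and the two convolutions evaluated at z *)

Section phase_space.
Context (R : realType) (d : nat).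
Local Notation leb := (lebesgue_n R d).
Implicit Types (f psi : fct R d) (z : phase R d) (S : oper R d) (w t : Rn R d).

Definition shift (a t : Rn R d) : Rn R d :=
  tuple_map (fun i x => x - tnth a i) t.

Definition opp_tuple (t : Rn R d) : Rn R d := tuple_map (fun _ x => - x) t.

Definition wave (w t : Rn R d) : R[i] :=
  cos (2 * pi * dotp w t) +i* sin (2 * pi * dotp w t).

Lemma shift_measure_preserving a : measure_preserving leb (shift a).
Proof.
by apply: measure_preserving_tuple_map => i; exact: measure_preserving_shift.
Qed.

Lemma opp_measure_preserving : measure_preserving leb opp_tuple.
Proof.
by apply: measure_preserving_tuple_map => i; exact: measure_preserving_opp.
Qed.

Lemma opp_tupleK : involutive opp_tuple.
Proof.
by move=> t; apply: eq_from_tnth => i; rewrite !tnth_mktuple opprK.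
Qed.

Lemma shift_oppK a : cancel (shift (opp_tuple a)) (shift a).
Proof.
by move=> t; apply: eq_from_tnth => i; rewrite !tnth_mktuple opprK addrK.
Qed.

Lemma measurable_wave w : measurable_fct (wave w).
Proof.
have mdot : measurable_fun setT (fun t => 2 * pi * dotp w t).
  apply: measurable_funM; first exact: measurable_cst.
  apply: measurable_sum => i; apply: measurable_funM.
    exact: measurable_cst.
  exact: measurable_tnth.
split; apply: measurableT_comp mdot.
- by apply: continuous_measurable_fun; exact: continuous_cos.
- by apply: continuous_measurable_fun; exact: continuous_sin.
Qed.

Lemma sqmod_wave w t : sqmod (wave w t) = 1.
Proof. exact: cos2Dsin2. Qed.

(** The identity e^{-2 pi i w.(t+a)} = e^{-2 pi i w.a} e^{2 pi i w.(-t)}. It splits the weight of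
    the adjoint of pi(z) into a constant phase and the weight of P pi(z) P. *)
Lemma conj_wave_shift w a t :
  conjc (wave w (shift (opp_tuple a) t)) =
  conjc (wave w a) * wave w (opp_tuple t).
Proof.
have dotD : dotp w (shift (opp_tuple a) t) = dotp w t + dotp w a.
  rewrite /dotp -big_split; apply: eq_bigr => i _.
  by rewrite !tnth_mktuple opprK mulrDr.
have dotN : dotp w (opp_tuple t) = - dotp w t.
  rewrite /dotp -sumrN; apply: eq_bigr => i _.
  by rewrite tnth_mktuple mulrN.
rewrite /wave dotD dotN mulrDr mulrN cosN sinN cosD sinD.
by apply/eqP; rewrite eq_complex /=; apply/andP; split; apply/eqP; ring.
Qed.

Lemma parityE : @parity R d = weighted_comp (fun=> 1) opp_tuple.
Proof.
by apply/funext => f; apply/funext => t; rewrite /weighted_comp mul1r.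
Qed.

Lemma sqmod1 : sqmod (1 : R[i]) = 1.
Proof. by rewrite /sqmod /= expr1n expr0n addr0. Qed.

Lemma bounded_tfshift z : bounded_op (tfshift z).
Proof.
apply: bounded_weighted_comp; first exact: measurable_wave.
  exact: sqmod_wave.
exact: shift_measure_preserving.
Qed.

Lemma bounded_parity : bounded_op (@parity R d).
Proof.
rewrite parityE; apply: bounded_weighted_comp.
- exact: measurable_fct_cst.
- by move=> t; exact: sqmod1.
- exact: opp_measure_preserving.
Qed.

Lemma parityK : involutive (@parity R d).
Proof.
move=> f; apply/funext => t.
by rewrite -[LHS]/(f (opp_tuple (opp_tuple t))) opp_tupleK.
Qed.

Lemma checkK S : check (check S) = S.
Proof. by apply/funext => f; rewrite /check /= !parityK. Qed.

Lemma inner_parity f g : L2 f -> L2 g ->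
  inner (parity f) (parity g) = inner f g.
Proof.
move=> fL gL; rewrite parityE inner_weighted_comp//.
- by move=> t; exact: sqmod1.
- exact: opp_measure_preserving.
Qed.

Lemma parity_adjoint : adjoint_pair (@parity R d) (@parity R d).
Proof.
move=> f g fL gL; rewrite -[LHS]inner_parity ?parityK//.
exact: (bounded_op_L2 bounded_parity).
Qed.

(** The explicit adjoint of a weighted composition translates by -x and conjugates the wave;
    [conj_wave_shift] rewrites it as a phase times P pi(z) P. *)
Lemma adjoint_tfshift z :
  [/\ bounded_op (adjoint (tfshift z)),
      adjoint_pair (tfshift z) (adjoint (tfshift z)) &
      forall f, L2 f -> adjoint (tfshift z) f =
        (fun t => conjc (wave z.2 z.1) * parity (tfshift z (parity f)) t)
        %[ae leb]].
Proof.
have mw := measurable_wave z.2; have w1 := sqmod_wave z.2.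
have gP := shift_measure_preserving z.1.
have hP := shift_measure_preserving (opp_tuple z.1).
have [|adjb adjp adjE] := adjointE (bounded_op_L2 (bounded_tfshift z)) _
    (weighted_comp_adjoint mw w1 gP hP (shift_oppK z.1)).
  apply: bounded_weighted_comp => //; first exact: measurable_weight_adjoint.
  by move=> t; rewrite sqmod_conj.
split=> // f fL; apply: filterS (adjE f fL) => t /[apply] ->.
rewrite /weighted_comp conj_wave_shift -mulrA; congr (_ * (_ * f _)).
by apply: eq_from_tnth => i; rewrite !tnth_mktuple opprD !opprK.
Qed.

(** Conjugating psi (x) psi by P and then by pi(z) gives the rank one operator of phi = pi(z) P psi.
    The trace is therefore <P S P phi, phi>, and moving P across yields eta = P phi. *)
Lemma trace_alpha_rank_one S psi z :
  (exists e : nat -> fct R d, orthonormal_basis e) -> bounded_op S -> L2 psi ->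
  let eta := parity (tfshift z (parity psi)) in
  conv_op_op (check S) (rank_one psi) z = inner (S eta) eta.
Proof.
move=> eX Sb pL eta.
have Pb := bounded_parity; have Tb := bounded_tfshift z.
have [adjb adjp _] := adjoint_tfshift z.
have PL f : L2 f -> L2 (parity f) by exact: (bounded_op_L2 Pb).
have TL f : L2 f -> L2 (tfshift z f) by exact: (bounded_op_L2 Tb).
have cSb : bounded_op (check S).
  by do 2 apply: bounded_op_comp => //.
set phi := tfshift z (parity psi).
have phiL : L2 phi by exact/TL/PL.
have SL : L2 (S (parity phi)) by exact/(bounded_op_L2 Sb)/PL.
rewrite /conv_op_op (@trace_of_rank_one _ _ _ phi (check S phi))//.
- by rewrite /check /= parity_adjoint//; exact: PL.
- exact: (bounded_op_L2 cSb).
- apply: bounded_op_L2; do ! apply: bounded_op_comp => //.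
  exact: bounded_rank_one.
- move=> f fL.
  (* Moving P and then the adjoint of pi(z) to the other side identifies the coefficient produced by
     [rank_one psi]. *)
  have <- : inner (parity (adjoint (tfshift z) f)) psi = inner f phi.
    have fL' := bounded_op_L2 adjb fL.
    rewrite parity_adjoint// (inner_conj (PL _ pL) fL').
    by rewrite -adjp//; [rewrite -inner_conj//|exact: PL].
  apply: ae_eq_trans (bounded_opZ _ cSb phiL).
  apply: aeW => t _; congr (check S _ t); apply/funext => s.
  by rewrite /rank_one /phi /tfshift /parity /= mulrCA.
Qed.

(** The two reflections of [S] cancel, so the trace is <S u, u> with u the adjoint of pi(z) applied
    to [psi]. This u is a unimodular multiple of eta, and the phase drops out of the sesquilinear
    expression. *)
Lemma cohen_classE S psi z :
  (exists e : nat -> fct R d, orthonormal_basis e) -> bounded_op S -> L2 psi ->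
  let eta := parity (tfshift z (parity psi)) in
  cohen_class S psi z = inner (S eta) eta.
Proof.
move=> eX Sb pL eta.
have Pb := bounded_parity; have Tb := bounded_tfshift z.
have [adjb adjp adjE] := adjoint_tfshift z.
have etaL : L2 eta.
  by apply: bounded_op_L2 => //; apply: bounded_op_L2 => //;
    exact: bounded_op_L2.
have aL := bounded_op_L2 adjb pL.
have SL := bounded_op_L2 Sb.
rewrite /cohen_class /conv_op_op checkK trace_rank_one_comp//; last first.
  by do ! apply: bounded_op_comp => //.
rewrite /alpha /= adjp//; last exact: SL.
set c := conjc (wave z.2 z.1).
have ceL : L2 (fun t => c * eta t) by exact: L2Z.
have Sae := bounded_op_ae Sb aL ceL (adjE _ pL).
rewrite (ae_eq_inner (SL _ aL) (L2Z c (SL _ etaL)) aL ceL _ (adjE _ pL)).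
  rewrite innerZl//; last exact: SL.
  rewrite innerZr//; last exact: SL.
  by rewrite mulrA mulC_conj sqmod_conj sqmod_wave mul1r.
exact: ae_eq_trans Sae (bounded_opZ c Sb etaL).
Qed.

End phase_space.

(** * Densities *)

Section density.
Context dT (T : measurableType dT) (R : realType).
Variable mu : {measure set T -> \bar R}.
Variable f : T -> \bar R.
Hypothesis mf : measurable_fun setT f.
Hypothesis f0 : forall t, (0 <= f t)%E.
Hypothesis f1 : (\int[mu]_t f t = 1)%E.

Definition density (A : set T) : \bar R := (\int[mu]_(t in A) f t)%E.

Let density0 : density set0 = 0%E. Proof. exact: integral_set0. Qed.

Let density_ge0 A : (0 <= density A)%E. Proof. exact: integral_ge0. Qed.

Let density_sigma_additive : semi_sigma_additive density.
Proof. exact: semi_sigma_additive_nng_induced. Qed.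

HB.instance Definition _ := isMeasure.Build _ _ _ density
  density0 density_ge0 density_sigma_additive.

HB.instance Definition _ := @Measure_isProbability.Build _ _ _ density f1.

(** Hides the structure instances behind an existential: what remains is a probability together with
    its integral formula. *)
Lemma exists_density_probability :
  exists P : probability T R, forall A, P A = (\int[mu]_(t in A) f t)%E.
Proof. by exists (density : probability T R). Qed.

End density.

Lemma density_dominated dT (T : measurableType dT) (R : realType)
    (mu : {measure set T -> \bar R}) (nu : set T -> \bar R) (f : T -> \bar R) :
  measurable_fun setT f -> (forall A, nu A = (\int[mu]_(t in A) f t)%E) ->
  nu `<< mu.
Proof.
move=> mf nuE; apply/null_content_dominatesP => A mA A0.
by rewrite nuE null_set_integral//; exact: measurable_funTS.
Qed.

(** The derivative and [f] are integrable with equal integrals over every measurable set, hence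
    equal almost everywhere. *)
Lemma Radon_Nikodym_density dT (T : measurableType dT) (R : realType)
    (mu : {sigma_finite_measure set T -> \bar R})
    (nu : {charge set T -> \bar R}) (f : T -> \bar R) :
  mu.-integrable setT f -> (forall A, nu A = (\int[mu]_(t in A) f t)%E) ->
  'd nu '/d mu = f %[ae mu].
Proof.
move=> fi nuE; have mf := measurable_int mu fi.
have numu : nu `<< mu by exact: density_dominated mf nuE.
apply: integral_ae_eq => //; first exact: Radon_Nikodym_integrable.
by move=> A _ mA; rewrite -Radon_Nikodym_integral// nuE.
Qed.

Lemma cintegral_indic (R : realType) (d : nat) (Omega : set (phase R d))
    (q : phase R d -> R[i]) :
  cintegral (lebesgue_phase R d) setT (fun z => cindic Omega z * q z) =
  cintegral (lebesgue_phase R d) Omega q.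
Proof.
rewrite /cintegral; congr (_ +i* _).
- rewrite [RHS]Rintegral_mkcond; apply: eq_Rintegral => z _.
  rewrite patchE /cindic indicE; case: (q z) => a b; case: ifP => _ /=.
    by rewrite mul1r mul0r subr0.
  by rewrite !mul0r subr0.
- rewrite [RHS]Rintegral_mkcond; apply: eq_Rintegral => z _.
  rewrite patchE /cindic indicE; case: (q z) => a b; case: ifP => _ /=.
    by rewrite mul1r mul0r addr0.
  by rewrite !mul0r addr0.
Qed.

(* No basis of L^2(R^d) has to be constructed: one is part of the trace class
   hypothesis. *)
Lemma trace_class_onb (R : realType) (d : nat) (S : oper R d) :
  trace_class S -> exists e : nat -> fct R d, orthonormal_basis e.
Proof. by move=> [_ [B [_ _ _ [t [e eP _]]]]]; exists e. Qed.

(** * Cohen's class distribution as density of the induced measure *)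

Theorem lemma9p2 (R : realType) (d : nat) (d_gt0 : (0 < d)%N)
    (S : oper R d) (S_trace_class : trace_class S) (S_positive : positive_op S)
    (S_trace1 : trace S = 1)
    (F : set (phase R d) -> oper R d)
    (F_conv : forall Omega : set (phase R d), measurable Omega ->
      is_conv_fun_op (cindic Omega) S (F Omega))
    (F_povm : is_povm F)
    (psi : fct R d) (psi_L2 : L2 psi) (psi_norm1 : L2norm psi = 1) :
  exists mu : probability (phase R d) R,
    [/\ forall Omega : set (phase R d), measurable Omega ->
          (fine (mu Omega))%:C = povm_measure F psi Omega,
        cintegrable (lebesgue_phase R d) setT (cohen_class S psi),
        forall Omega : set (phase R d), measurable Omega ->
          povm_measure F psi Omega =
          cintegral (lebesgue_phase R d) Omega (cohen_class S psi),
        mu `<< (lebesgue_phase R d) &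
        {ae (lebesgue_phase R d), forall z,
          (fine (('d (charge_of_finite_measure mu) '/d (lebesgue_phase R d)) z))%:C
            = cohen_class S psi z}].
Proof.
have onb := trace_class_onb S_trace_class.
have Sb : bounded_op S by case: S_trace_class.
set Q := cohen_class S psi.
(* Through the form <S eta, eta>, positivity of [S] makes [Q] real and nonnegative at every point,
   so its real part can serve as a density. *)
have Q_ge0 z : 0 <= Q z.
  rewrite /Q cohen_classE//; apply: S_positive.
  apply: (bounded_op_L2 (@bounded_parity R d)).
  apply: (bounded_op_L2 (bounded_tfshift z)).
  exact: (bounded_op_L2 (@bounded_parity R d)).
have QRe z : Q z = (complex.Re (Q z))%:C.
  by apply/eqP; rewrite eq_complex /= eqxx (ger0_Im (Q_ge0 z)) eqxx.
have ReQ_ge0 z : 0 <= complex.Re (Q z).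
  by have := Q_ge0 z; rewrite QRe lecR.
have convE : conv_op_op (check S) (rank_one psi) = Q.
  by apply/funext => z; rewrite trace_alpha_rank_one// /Q cohen_classE.
have FQ Omega : measurable Omega ->
    cintegrable (lebesgue_phase R d) setT (fun z => cindic Omega z * Q z) /\
    povm_measure F psi Omega = cintegral (lebesgue_phase R d) Omega Q.
  move=> mOmega; have [Fb] := F_conv _ mOmega.
  move=> /(_ _ (trace_class_rank_one onb psi_L2 psi_norm1)).
  rewrite convE cintegral_indic => -[? <-]; split=> //.
  have FL := bounded_op_L2 Fb.
  (* The composite sends f to <f, psi> F(Omega) psi almost everywhere, so its trace is <F(Omega)
     psi, psi>. *)
  rewrite (trace_of_rank_one onb psi_L2 (FL _ psi_L2))//.
  - move=> f fL; apply: FL; exact: L2Z.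
  - by move=> f fL; exact: bounded_opZ.
(* Integrability of [Q] itself is the instance Omega = R^{2d}, where the indicator is 1. *)
have Qi : cintegrable (lebesgue_phase R d) setT Q.
  have [+ _] := FQ _ measurableT.
  rewrite (_ : (fun z => _) = Q)//; apply/funext => z.
  by rewrite /cindic indicT /= mul1r.
have [ReQi _] := Qi.
have FRe Omega : measurable Omega -> povm_measure F psi Omega =
    (fine (\int[lebesgue_phase R d]_(z in Omega) (complex.Re (Q z))%:E)%E)%:C.
  move=> mOmega; have [_ ->] := FQ _ mOmega.
  apply/eqP; rewrite eq_complex /= eqxx /=; apply/eqP.
  rewrite (_ : (fun z => complex.Im _) = cst 0).
    by rewrite Rintegral_cst// mul0r.
  by apply/funext => z; rewrite /= ger0_Im.
(* The total mass is <F(R^{2d}) psi, psi> = |psi|^2. Integrability must come first: [fine] would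
   also send an infinite integral to a real number. *)
have int1 : (\int[lebesgue_phase R d]_z (complex.Re (Q z))%:E = 1)%E.
  rewrite -[LHS]fineK; last exact: integrable_fin_num.
  congr EFin; apply: (@complexI R); rewrite -FRe//.
  rewrite /povm_measure.
  have FL := bounded_op_L2 (povm_bounded F_povm measurableT).
  rewrite (ae_eq_inner (FL _ psi_L2) psi_L2 psi_L2 psi_L2
    (povm_setT F_povm psi_L2) (ae_eq_refl _ _ _)).
  by rewrite inner_self// psi_norm1 expr1n.
have [||P PE] := exists_density_probability _ _ int1.
- exact: measurable_int ReQi.
- by move=> z; rewrite lee_fin.
exists P; split=> //.
- by move=> Omega mOmega; rewrite FRe// PE.
- by move=> Omega mOmega; have [] := FQ _ mOmega.
- exact: density_dominated (measurable_int _ ReQi) PE.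
(* The derivative is found to be the real part of [Q], from which [QRe] recovers [Q]. *)
- have := @Radon_Nikodym_density _ _ _ (lebesgue_phase R d)
    (charge_of_finite_measure P) _ ReQi PE.
  by apply: filterS => z /(_ I) ->; rewrite /= -QRe.
Qed.
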